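(* Assume $A\cap B=\emptyset$, $C\ne[m]$ and $|A|\ge2$. (a) If $q\ge3$, or $q=2$ and $|[m]\setminus C|\ge2$, then $\mathcal C_{\overline{\mathcal N}_4}$ is a $q$-ary $\left[\frac{2(q^m-q^{|C|})(q^{|A|}-1)q^{|B|}}{q-1},\ m+2|A|+|B|,\ (q^m-q^{|C|})q^{|A|+|B|-1}\right]$ locally repairable code with locality $2$. (b) If $q=2$ and $|[m]\setminus C|=1$, then $\mathcal C_{\overline{\mathcal N}_4}$ is a binary $\left[(2^{|A|}-1)2^{m+|B|},\ m+2|A|+|B|,\ 2^{m+|A|+|B|-2}\right]$ locally repairable code with locality $3$.
   Context: $q$ is a prime power, $\mathbb F_q$ the field of order $q$, $\mathbb F_q^*=\mathbb F_q\setminus\{0\}$, $m\ge2$, $[m]=\{1,\dots,m\}$, $\mathrm{supp}(v)=\{i:v_i\ne0\}$. For nonempty $P\subseteq[m]$, $\Delta_P=\{v\in\mathbb F_q^m:\mathrm{supp}(v)\subseteq P\}$, $\Delta_P^c=\mathbb F_q^m\setminus\Delta_P$, $\Delta_P^*=\Delta_P\setminus\{\mathbf 0\}$. $A,B,C$ are nonempty subsets of $[m]$. Let $\mathcal N_4=\{(w_2+\omega,w_3,w_1)\in\mathbb F_q^{3m}: w_1\in\Delta_A^*,\ w_2\in\Delta_B,\ w_3\in\Delta_C^c,\ \omega\in\{\mathbf 0,w_1\}\}$ (closed under multiplication by $\mathbb F_q^*$), let $\overline{\mathcal N}_4$ contain exactly one element of each class $\{\alpha x:\alpha\in\mathbb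 F_q^*\}$, $x\in\mathcal N_4$, let $G$ be the $3m\times|\overline{\mathcal N}_4|$ matrix whose columns are the elements of $\overline{\mathcal N}_4$, and let $\mathcal C_{\overline{\mathcal N}_4}$ be its row span over $\mathbb F_q$. The code has locality $r$ (with respect to $G$) if $r$ is the least positive integer such that every column of $G$ is an $\mathbb F_q$-linear combination of at most $r$ other columns of $G$; a $q$-ary $[n,k,d]$ locally repairable code with locality $r$ is a linear $[n,k,d]$ code with locality $r$. *)

(* Defs.v *)
From HB Require Import structures.
From mathcomp Require Import all_boot all_order all_algebra.
Set Implicit Arguments. Unset Strict Implicit. Unset Printing Implicit Defensive.
Import GRing.Theory.
Local Open Scope ring_scope.

Section Defs.
Variable F : finFieldType.

Definition supp (m : nat) (v : 'rV[F]_m) : {set 'I_m} := [set i | v 0 i != 0].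

Definition inDelta (m : nat) (P : {set 'I_m}) (v : 'rV[F]_m) : bool :=
  supp v \subset P.

Definition inN4 (m : nat) (A B C : {set 'I_m}) (x : 'rV[F]_(m + (m + m))) : Prop :=
  exists (w1 w2 w3 omega : 'rV[F]_m),
    [/\ inDelta A w1 /\ w1 != 0, inDelta B w2, ~~ inDelta C w3,
        (omega = 0 \/ omega = w1) &
        x = row_mx (w2 + omega) (row_mx w3 w1)].

Definition projRepr (m : nat) (A B C : {set 'I_m})
    (S : {set 'rV[F]_(m + (m + m))}) : Prop :=
  (forall y, y \in S -> inN4 A B C y) /\
  (forall x, inN4 A B C x ->
     exists! y, y \in S /\ exists a : F, a != 0 /\ y = a *: x).

Definition genmat (N : nat) (S : {set 'rV[F]_N}) : 'M[F]_(N, #|S|) :=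
  \matrix_(i < N, j < #|S|) (enum_val j) 0 i.

Definition wt (n : nat) (c : 'rV[F]_n) : nat := #|[set j | c 0 j != 0]|.

Definition min_dist (N n : nat) (G : 'M[F]_(N, n)) (d : nat) : Prop :=
  (exists u : 'rV[F]_N, u *m G != 0 /\ wt (u *m G) = d) /\
  (forall u : 'rV[F]_N, u *m G != 0 -> (d <= wt (u *m G))%N).

Definition repair_r (N n : nat) (G : 'M[F]_(N, n)) (r : nat) : Prop :=
  forall j : 'I_n, exists (T : {set 'I_n}) (c : 'I_n -> F),
    [/\ j \notin T, (#|T| <= r)%N & col j G = \sum_(i in T) c i *: col i G].

Definition locality (N n : nat) (G : 'M[F]_(N, n)) (r : nat) : Prop :=
  [/\ (0 < r)%N, repair_r G r &
      forall r', (0 < r')%N -> repair_r G r' -> (r <= r')%N].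

Definition is_LRC (N n : nat) (G : 'M[F]_(N, n)) (n' k d r : nat) : Prop :=
  [/\ n = n', \rank G = k, min_dist G d & locality G r].

End Defs.

(* Main.v *)
Require Import Defs.
From HB Require Import structures.
From mathcomp Require Import all_boot all_order all_algebra.
From mathcomp Require Import zify ring.
Set Implicit Arguments. Unset Strict Implicit. Unset Printing Implicit Defensive.
Import GRing.Theory.
Local Open Scope ring_scope.

(* Scaling lets every count be made over N_4 itself and divided by q - 1.  Write
   a = |A|, b = |B|, c = |C|.  For a row u = (u1, u2, u3), the codeword entry at
   (w2 + e w1, w3, w1) is u1.w2 + u2.w3 + (e u1 + u3).w1, and a functional that is
   nonzero on a coordinate subspace takes each value equally often there.  If u1 is
   nonzero on B, or u2 on C, this fixes the weight, and 2 (q^a - 1) >= q^a bounds it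
   below; if u2 = 0 it remains to see that e u1 + u3 is nonzero on A for some e; if
   u2 <> 0 vanishes on C, the bound reduces to
   q^(m+a-1) >= 2 q^(m-1) + q^(c+a-1).  Since this excludes weight 0, it also
   determines the left kernel of G, hence its rank.

   For the locality, choose w in Delta_A not proportional to w1.  If a vector w3
   outside Delta_C splits as v + v' with both parts outside Delta_C, then a column
   splits along w1 = w + (w1 - w) and w3 = v + v'.  If q = 2 and C misses only the
   index k, all columns have k-th w3-coordinate 1, so only odd sums of columns are
   columns; for a unit vector e_i with i in B,
   (w2 + omega, w3, w1) = (w2 + e_i + omega, w3, w1) + (e_i, w3, w) + (0, w3, w). *)

(** * Coordinate subspaces Delta_P and their size *)

Section Coordinate.
Variables (F : finFieldType) (m : nat).
Implicit Types (P : {set 'I_m}) (u v w : 'rV[F]_m).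

Definition Delta P : {set 'rV[F]_m} := [set v | inDelta P v].

Lemma DeltaP P v : reflect (forall i, i \notin P -> v 0 i = 0) (v \in Delta P).
Proof.
rewrite inE; apply: (iffP subsetP) => [sPv i|vP i].
  by apply: contraNeq => vi; apply: sPv; rewrite inE.
by rewrite inE; apply: contraNT => /vP ->.
Qed.

Lemma Delta0 P : 0 \in Delta P.
Proof. by apply/DeltaP => i _; rewrite mxE. Qed.

Lemma DeltaD P v w : v \in Delta P -> w \in Delta P -> v + w \in Delta P.
Proof.
move=> /DeltaP vP /DeltaP wP; apply/DeltaP=> i iP.
by rewrite mxE vP ?wP ?addr0.
Qed.

Lemma DeltaZ P a v : v \in Delta P -> a *: v \in Delta P.
Proof. by move=> /DeltaP vP; apply/DeltaP=> i iP; rewrite mxE vP ?mulr0. Qed.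

Lemma DeltaZE P a v : a != 0 -> (a *: v \in Delta P) = (v \in Delta P).
Proof.
move=> a0; apply/idP/idP; last exact: DeltaZ.
by move/(DeltaZ a^-1); rewrite scalerA mulVf ?scale1r.
Qed.

Lemma DeltaB P v w : v \in Delta P -> w \in Delta P -> v - w \in Delta P.
Proof. by move=> vP wP; rewrite -scaleN1r DeltaD ?DeltaZ. Qed.

Lemma Delta_delta P i : (delta_mx 0 i \in Delta P) = (i \in P).
Proof.
apply/DeltaP/idP => [d|iP j jP].
  by apply/negPn/negP => /d /eqP; rewrite mxE !eqxx oner_eq0.
by rewrite mxE eqxx; case: (j =P i) jP => [->|//]; rewrite iP.
Qed.

Lemma DeltaT : Delta setT = setT.
Proof. by apply/setP=> v; rewrite !inE /inDelta subsetT. Qed.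

Lemma card_Delta P : #|Delta P| = (#|F| ^ #|P|)%N.
Proof.
(* Vectors supported in P are the functions taking the default value 0 off P. *)
have -> : Delta P = [set \row_i (f : {ffun _ -> F}) i | f in pffun_on (0 : F) P predT].
  apply/setP=> v; apply/DeltaP/imsetP => [vP|[f /pffun_onP[/subsetP sf _] -> i iP]].
    exists [ffun i => v 0 i]; last by apply/rowP=> i; rewrite mxE ffunE.
    apply/pffun_onP; split=> //; apply/subsetP=> i; rewrite inE ffunE.
    by apply: contraNT => /vP ->.
  by rewrite mxE; apply/eqP; apply: contraNT iP; apply: sf.
rewrite card_in_imset ?card_pffun_on // => f g _ _ /rowP fg.
by apply/ffunP => i; have := fg i; rewrite !mxE.
Qed.

End Coordinate.

(** * The dot product and the value distribution of a functional on Delta_P *)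

Section Dot.
Variable F : finFieldType.

Definition dot n (u v : 'rV[F]_n) : F := (u *m v^T) 0 0.

Lemma dotE n (u v : 'rV[F]_n) : dot u v = \sum_i u 0 i * v 0 i.
Proof. by rewrite /dot mxE; apply: eq_bigr => i _; rewrite mxE. Qed.

Lemma dotDr n (u v w : 'rV[F]_n) : dot u (v + w) = dot u v + dot u w.
Proof. by rewrite /dot linearD mulmxDr mxE. Qed.

Lemma dotDl n (u v w : 'rV[F]_n) : dot (u + v) w = dot u w + dot v w.
Proof. by rewrite /dot mulmxDl mxE. Qed.

Lemma dotZr n a (u v : 'rV[F]_n) : dot u (a *: v) = a * dot u v.
Proof. by rewrite /dot linearZ -scalemxAr mxE. Qed.

Lemma dotZl n a (u v : 'rV[F]_n) : dot (a *: u) v = a * dot u v.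
Proof. by rewrite /dot -scalemxAl mxE. Qed.

Lemma dot0r n (u : 'rV[F]_n) : dot u 0 = 0.
Proof. by rewrite /dot trmx0 mulmx0 mxE. Qed.

Lemma dot0l n (u : 'rV[F]_n) : dot 0 u = 0.
Proof. by rewrite /dot mul0mx mxE. Qed.

Lemma dot_delta n (u : 'rV[F]_n) i : dot u (delta_mx 0 i) = u 0 i.
Proof. by rewrite /dot trmx_delta -colE mxE. Qed.

Lemma delta_dot n (u : 'rV[F]_n) i : dot (delta_mx 0 i) u = u 0 i.
Proof. by rewrite /dot -rowE !mxE. Qed.

Lemma dot_row_mx n1 n2 (u1 v1 : 'rV[F]_n1) (u2 v2 : 'rV[F]_n2) :
  dot (row_mx u1 u2) (row_mx v1 v2) = dot u1 v1 + dot u2 v2.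
Proof. by rewrite /dot tr_row_mx mul_row_col mxE. Qed.

Variable m : nat.
Implicit Types (P : {set 'I_m}) (u v w : 'rV[F]_m).

(** This says that the functional [dot u] is zero on Delta_P, since only the coordinates in P matter
    there. *)
Definition vanish P u := [forall i in P, u 0 i == 0].

Lemma vanishP P u : reflect (forall i, i \in P -> u 0 i = 0) (vanish P u).
Proof.
by apply: (iffP forall_inP) => uP i /uP; [move/eqP | move=> ->].
Qed.

Lemma dot_vanish P u w : vanish P u -> w \in Delta F P -> dot u w = 0.
Proof.
move=> /vanishP uP /DeltaP wP; rewrite dotE big1 // => i _.
by case: (boolP (i \in P)) => [/uP ->|/wP ->]; rewrite (mul0r, mulr0).
Qed.

Lemma vanishT u : vanish setT u = (u == 0).
Proof.
apply/vanishP/eqP => [u0|-> i _]; last by rewrite mxE.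
by apply/rowP=> i; rewrite u0 ?mxE ?inE.
Qed.

(** If u_i is nonzero with i in P, translation by a multiple of e_i carries the fibre over 0 onto
    the fibre over t. Hence the q fibres have equal size. *)
Lemma card_fiber P u s : ~~ vanish P u ->
  #|[set w in Delta F P | dot u w == s]| = (#|F| ^ #|P|.-1)%N.
Proof.
case/forall_inPn => i iP ui.
have P0 : (0 < #|P|)%N by apply/card_gt0P; exists i.
have translate t : #|[set w in Delta F P | dot u w == t]| =
    #|[set w in Delta F P | dot u w == 0]|.
  pose e : 'rV[F]_m := (t / u 0 i) *: delta_mx 0 i.
  have eP : e \in Delta F P by rewrite DeltaZ ?Delta_delta.
  have ue : dot u e = t by rewrite dotZr dot_delta divfK.
  rewrite -(card_imset [set w in Delta F P | dot u w == 0] (addIr e)).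
  apply: eq_card => w; rewrite [LHS]inE; apply/andP/imsetP.
    case=> wP /eqP uw; exists (w - e); last by rewrite subrK.
    by rewrite inE DeltaB //= -scaleN1r dotDr dotZr uw ue mulN1r subrr.
  case=> v; rewrite inE => /andP[vP /eqP uv] ->.
  by rewrite DeltaD // dotDr uv add0r ue.
have : #|Delta F P| = (#|F| * #|[set w in Delta F P | dot u w == s]|)%N.
  rewrite -sum1_card (partition_big (dot u) predT) //= translate -sum_nat_const.
  apply: eq_bigr => t _; rewrite -(translate t) -sum1_card.
  by apply: eq_bigl => w; rewrite !inE.
rewrite card_Delta -(prednK P0) expnS => /eqP.
by rewrite eqn_pmul2l ?(ltnW (card_finNzRing_gt1 F)) // => /eqP.
Qed.

(** Only the fibre over -t is lost, and its size does not depend on t. Booleans are summed so that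
    nested sums can be reordered. *)
Lemma sum_Delta_neq P u t : ~~ vanish P u ->
  (\sum_(w in Delta F P) (dot u w + t != 0)%R = #|F|.-1 * #|F| ^ #|P|.-1)%N.
Proof.
move=> uP; have P0 : (0 < #|P|)%N.
  by case/forall_inPn: uP => i iP _; apply/card_gt0P; exists i.
have q0 : (0 < #|F|)%N by apply: ltnW (card_finNzRing_gt1 F).
have : (\sum_(w in Delta F P) (dot u w + t != 0)%R
   + \sum_(w in Delta F P) (dot u w == - t)%R = #|Delta F P|)%N.
  rewrite -big_split -sum1_card /=; apply: eq_bigr => w _.
  by rewrite addr_eq0; case: (_ == _).
have -> : (\sum_(w in Delta F P) (dot u w == - t)%R =
           #|[set w in Delta F P | dot u w == - t]|)%N.
  by rewrite -big_mkcondr -sum1_card; apply: eq_bigl => w; rewrite !inE.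
have -> : #|Delta F P| = (#|F|.-1 * #|F| ^ #|P|.-1 + #|F| ^ #|P|.-1)%N.
  by rewrite card_Delta -{1}(prednK P0) expnS -{1}(prednK q0) mulSn addnC.
by rewrite card_fiber // => /addIn.
Qed.

End Dot.

(** * The set N_4: parametrisation, scaling and projective representatives *)

Section N4.
Variables (F : finFieldType) (m : nat) (A B C : {set 'I_m}).
Local Notation V := 'rV[F]_m.
Local Notation Delta := (Delta F).

(** The choice of omega in {0, w1} becomes a boolean e with omega = e w1, so that N_4 is the image
    of a product set. *)
Definition N4dom : {set bool * V * V * V} :=
  [set p | [&& p.1.1.2 \in Delta A :\ (0%R : V), p.1.2 \in Delta B & p.2 \in ~: Delta C]].

Lemma mem_N4dom e w1 w2 w3 : ((e, w1, w2, w3) \in N4dom) =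
  [&& w1 != 0, w1 \in Delta A, w2 \in Delta B & w3 \notin Delta C].
Proof. by rewrite in_set /= in_setD1 in_setC -andbA. Qed.

Definition N4vec (p : bool * V * V * V) : 'rV[F]_(m + (m + m)) :=
  let: (e, w1, w2, w3) := p in row_mx (w2 + e%:R *: w1) (row_mx w3 w1).

Definition N4set := [set N4vec p | p in N4dom].

Lemma N4setP x : reflect (inN4 A B C x) (x \in N4set).
Proof.
apply: (iffP imsetP) => [[[[[e w1] w2] w3]]|[w1 [w2 [w3 [om [[w1A w1n0] w2B w3C omE ->]]]]]].
  rewrite !inE /= => /and3P[/andP[w1n0 w1A] w2B w3C] ->.
  exists w1, w2, w3, (e%:R *: w1); split=> //.
  by case: e; rewrite ?scale1r ?scale0r; [right | left].
exists (om != 0, w1, w2, w3); first by rewrite !inE /= w1n0 w1A w2B.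
by case: omE => -> /=; rewrite ?eqxx ?w1n0 ?scale0r ?scale1r.
Qed.

Lemma N4set_scale a x : a != 0 -> (a *: x \in N4set) = (x \in N4set).
Proof.
have scale b z : b != 0 -> z \in N4set -> b *: z \in N4set.
  move=> b0 /imsetP[[[[e w1] w2] w3]]; rewrite !inE -!in_set /= => h ->.
  apply/imsetP; exists (e, b *: w1, b *: w2, b *: w3).
    move: h; rewrite !inE /= scaler_eq0 (negbTE b0) /=.
    by have := DeltaZE A w1 b0; have := DeltaZE B w2 b0;
       have := DeltaZE C w3 b0; rewrite !inE => -> -> ->.
  by rewrite /= !scale_row_mx scalerDr !scalerA mulrC.
move=> a0; apply/idP/idP; last exact: scale.
by move/(scale a^-1); rewrite scalerA mulVf ?scale1r ?invr_eq0 //; apply.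
Qed.

Lemma N4set_neq0 x : x \in N4set -> x != 0.
Proof.
case/imsetP=> [[[[e w1] w2] w3]]; rewrite !inE => /andP[/andP[w1n0 _] _] ->.
by rewrite /= !row_mx_eq0 (negbTE w1n0) !andbF.
Qed.

(** The parametrisation is injective: at an index i in A with w1_i nonzero, w2 is zero because A and
    B are disjoint, so the first block shows e w1_i. This recovers e, and then w2. *)
Lemma card_N4set_sum (Q : pred 'rV[F]_(m + (m + m))) : A :&: B = set0 ->
  #|[set x in N4set | Q x]| =
  (\sum_(e : bool) \sum_(w1 in Delta A :\ (0%R : V)) \sum_(w2 in Delta B)
     \sum_(w3 in ~: Delta C) Q (N4vec (e, w1, w2, w3)))%N.
Proof.
move=> AB; have inj : {in N4dom &, injective N4vec}.
  move=> [[[e w1] w2] w3] [[[e' w1'] w2'] w3'].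
  rewrite !inE /= => /and3P[/andP[w1n0 w1A] w2B _] /and3P[_ w2B' _].
  case/eq_row_mx => + /eq_row_mx[-> w1E]; rewrite -{w1' }w1E.
  have ee : w2 + e%:R *: w1 = w2' + e'%:R *: w1 -> e = e'.
    move=> /rowP w2E.
    have [i /andP[iA w1i]] : exists i, (i \in A) && (w1 0 i != 0).
      apply/existsP; apply: contraNT w1n0; rewrite negb_exists => /forallP h.
      apply/eqP/rowP=> i; rewrite mxE; apply/eqP/negPn/negP=> w1i.
      have := h i; rewrite w1i andbT => /negP; apply.
      by move/subsetP: w1A; apply; rewrite inE.
    have iB : i \notin B.
      by have := in_set0 i; rewrite -AB inE iA /= => ->.
    have := w2E i; rewrite !mxE.
    have /DeltaP -> // : w2 \in Delta B by rewrite inE.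
    have /DeltaP -> // : w2' \in Delta B by rewrite inE.
    rewrite !add0r => /(mulIf w1i) {w2E}.
    by case: e e' => [] [] // /eqP; rewrite ?oner_eq0 // eq_sym oner_eq0.
  by move=> w2E; have E := ee w2E; rewrite -E in w2E *; rewrite (addIr _ w2E).
have -> : [set x in N4set | Q x] = [set N4vec p | p in [set p in N4dom | Q (N4vec p)]].
  apply/setP=> x; rewrite inE; apply/andP/imsetP.
    by case=> /imsetP[p pN ->] Qp; exists p; rewrite // inE pN.
  by case=> p; rewrite inE => /andP[pN Qp] ->; rewrite imset_f.
rewrite card_in_imset; last by move=> p p' /setIdP[pN _] /setIdP[p'N _]; exact: inj.
rewrite !pair_big /= -sum1_card big_mkcond [RHS]big_mkcond /=.
apply: eq_bigr => -[[[e w1] w2] w3] _ /=.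
rewrite !inE /= -!andbA; case: (w1 != 0) => //; case: (inDelta A w1) => //.
by case: (inDelta B w2) => //; case: (inDelta C w3) => //; case: (Q _).
Qed.

Variable S : {set 'rV[F]_(m + (m + m))}.
Hypothesis SP : projRepr A B C S.

Lemma projRepr_sub y : y \in S -> y \in N4set.
Proof. by case: SP => SN _ /SN /N4setP. Qed.

Lemma projRepr_ex x : x \in N4set -> exists2 a, a != 0 & a *: x \in S.
Proof. by case: SP => _ Sx /N4setP/Sx[y [[yS [a [a0 yE]]] _]]; exists a; rewrite -?yE. Qed.

Lemma projRepr_eq y z a : y \in S -> z \in S -> z = a *: y -> y = z.
Proof.
move=> yS zS zE; case: SP => SN /(_ y (SN y yS))[t [_ t_uniq]].
have a0 : a != 0.
  apply: contraTneq (N4set_neq0 (projRepr_sub zS)) => a0.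
  by rewrite zE a0 scale0r eqxx.
have yt : t = y by apply: t_uniq; split=> //; exists 1; rewrite scale1r oner_neq0.
by rewrite -yt; apply: t_uniq; split=> //; exists a.
Qed.

(** The map (a, y) to a y is a bijection from pairs of a nonzero scalar and an element of S onto
    N_4, and Q is constant on classes. *)
Lemma card_projRepr (Q : pred 'rV[F]_(m + (m + m))) :
  (forall a x, a != 0 -> Q (a *: x) = Q x) ->
  (#|[set y in S | Q y]| * #|F|.-1 = #|[set x in N4set | Q x]|)%N.
Proof.
move=> QZ; rewrite mulnC -(cardC1 (0 : F)) -[#|predC1 _|]cardsE -cardsX.
rewrite -(@card_in_imset _ _ (fun p => p.1 *: p.2)).
  apply: eq_card => x; rewrite [RHS]inE; apply/imsetP/andP.
    case=> -[a y]; rewrite !inE /= => /and3P[a0 yS Qy] ->.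
    by rewrite N4set_scale ?QZ ?projRepr_sub.
  case=> xN Qx; have [a a0 axS] := projRepr_ex xN.
  exists (a^-1, a *: x); first by rewrite !inE /= invr_eq0 a0 axS QZ.
  by rewrite /= scalerA mulVf ?scale1r.
move=> [a y] [b z]; rewrite !inE /= => /and3P[a0 yS _] /and3P[b0 zS _] E.
have zy : y = z.
  by apply: (projRepr_eq (a := b^-1 * a)) => //; rewrite -scalerA E scalerA mulVf ?scale1r.
rewrite -zy; congr (_, _); apply/eqP; rewrite -subr_eq0.
move/eqP: E; rewrite -zy -subr_eq0 -scalerBl scaler_eq0.
by rewrite (negbTE (N4set_neq0 (projRepr_sub yS))) orbF.
Qed.

End N4.

(** * Codeword weights, counted over N_4 *)

Section Weight.
Variables (F : finFieldType) (m : nat) (A B C : {set 'I_m}).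
Local Notation V := 'rV[F]_m.
Local Notation Delta := (Delta F).
Local Notation q := #|F|.
Implicit Types (u w : V).

Lemma sum_Delta_neq_vanish P u t : vanish P u ->
  (\sum_(w in Delta P) (dot u w + t != 0)%R = q ^ #|P| * (t != 0)%R)%N.
Proof.
move=> uP; rewrite -card_Delta -sum_nat_const; apply: eq_bigr => w wP.
by rewrite (dot_vanish uP wP) add0r.
Qed.

(** Counts over the complement of Delta_C are obtained from the whole space; the additive form
    avoids truncated subtraction. *)
Lemma sum_DeltaC_neq u t :
  (\sum_(w in Delta C) (dot u w + t != 0)%R +
   \sum_(w in ~: Delta C) (dot u w + t != 0)%R =
   if u == 0%R then q ^ m * (t != 0)%R else q.-1 * q ^ m.-1)%N.
Proof.
rewrite -vanishT; transitivity (\sum_(w in Delta setT) (dot u w + t != 0)%R)%N.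
  rewrite DeltaT [RHS](bigID (mem (Delta C))) /=; congr addn; apply: eq_bigl => w;
  by rewrite !inE.
case: ifP => [/sum_Delta_neq_vanish ->|/negbT/sum_Delta_neq ->];
by rewrite cardsT card_ord.
Qed.

(** The summand is the codeword entry at (w2 + e w1, w3, w1), regrouped as functionals of w3, w2 and
    w1. The total is q - 1 times the Hamming weight. *)
Definition codeweight (u1 u2 u3 : V) : nat :=
  (\sum_(e : bool) \sum_(w1 in Delta A :\ (0%R : V)) \sum_(w2 in Delta B)
     \sum_(w3 in ~: Delta C)
       (dot u2 w3 + (dot u1 w2 + dot (e%:R *: u1 + u3) w1) != 0)%R)%N.

Lemma card_Delta_neq0 : #|Delta A :\ (0%R : V)| = (q ^ #|A| - 1)%N.
Proof. by rewrite -card_Delta [in RHS](cardsD1 0) Delta0 addKn. Qed.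

Lemma card_DeltaC : #|~: Delta C| = (q ^ m - q ^ #|C|)%N.
Proof. by rewrite cardsCs setCK card_mx mul1n card_Delta. Qed.

Lemma sum_Delta1_neq u :
  (\sum_(w in Delta A :\ (0%R : V)) (dot u w != 0)%R
    = if vanish A u then 0 else q.-1 * q ^ #|A|.-1)%N.
Proof.
transitivity (\sum_(w in Delta A) (dot u w + 0 != 0)%R)%N.
  rewrite [RHS](big_setD1 (0 : V)) ?Delta0 //= dot0r addr0 eqxx add0n.
  by apply: eq_bigr => w _; rewrite addr0.
case: ifP => [/sum_Delta_neq_vanish ->|/negbT/sum_Delta_neq -> //].
by rewrite eqxx muln0.
Qed.

(** The sum over w2 has the same value for all e, w1 and w3, so it factors out. *)
Lemma codeweight_B u1 u2 u3 : ~~ vanish B u1 ->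
  codeweight u1 u2 u3 =
  (2 * ((q ^ #|A| - 1) * ((q ^ m - q ^ #|C|) * (q.-1 * q ^ #|B|.-1))))%N.
Proof.
move=> u1B; rewrite -card_bool -card_Delta_neq0 -card_DeltaC -!sum_nat_const.
apply: eq_bigr => e _; apply: eq_bigr => w1 _.
rewrite exchange_big /=; apply: eq_bigr => w3 _.
rewrite -(sum_Delta_neq (dot (e%:R *: u1 + u3) w1 + dot u2 w3) u1B).
by apply: eq_bigr => w2 _; rewrite addrC -addrA.
Qed.

Lemma codeweight_vanishB u1 u2 u3 : vanish B u1 ->
  codeweight u1 u2 u3 =
  (q ^ #|B| * \sum_(e : bool) \sum_(w1 in Delta A :\ (0%R : V))
     \sum_(w3 in ~: Delta C) (dot u2 w3 + dot (e%:R *: u1 + u3) w1 != 0)%R)%N.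
Proof.
move=> u1B; rewrite big_distrr /=; apply: eq_bigr => e _.
rewrite big_distrr /=; apply: eq_bigr => w1 _.
rewrite -card_Delta -sum_nat_const; apply: eq_bigr => w2 w2B.
by apply: eq_bigr => w3 _; rewrite (dot_vanish u1B w2B) add0r.
Qed.

Lemma codeweight_u2_0 u1 u3 : vanish B u1 ->
  codeweight u1 0%R u3 =
  (q ^ #|B| * \sum_(e : bool) (q ^ m - q ^ #|C|) *
     (if vanish A (e%:R *: u1 + u3)%R then 0 else q.-1 * q ^ #|A|.-1))%N.
Proof.
move=> u1B; rewrite codeweight_vanishB //; congr muln; apply: eq_bigr => e _.
rewrite -sum_Delta1_neq -card_DeltaC big_distrr /=; apply: eq_bigr => w1 _.
by rewrite -sum_nat_const; apply: eq_bigr => w3 _; rewrite dot0l add0r.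
Qed.

Lemma codeweight_u2 u1 u2 u3 : vanish B u1 -> u2 != 0 -> ~~ vanish C u2 ->
  codeweight u1 u2 u3 =
  (q ^ #|B| * (2 * ((q ^ #|A| - 1) * (q.-1 * q ^ m.-1 - q.-1 * q ^ #|C|.-1))))%N.
Proof.
move=> u1B u2n0 u2C; rewrite codeweight_vanishB //; congr muln.
rewrite -card_bool -card_Delta_neq0 -!sum_nat_const.
apply: eq_bigr => e _; apply: eq_bigr => w1 _.
by have := sum_DeltaC_neq u2 (dot (e%:R *: u1 + u3) w1);
  rewrite sum_Delta_neq // (negbTE u2n0) => <-; rewrite addKn.
Qed.

(** On Delta_C the entry depends on w1 alone, so for each e that part of the count is q^c times the
    number of w1 where e u1 + u3 is nonzero. This number is bounded above, and the bound is kept on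
    the right to avoid subtraction. *)
Lemma codeweight_u2_ge u1 u2 u3 : vanish B u1 -> u2 != 0 -> vanish C u2 ->
  (q ^ #|B| * (2 * ((q ^ #|A| - 1) * (q.-1 * q ^ m.-1))) <=
  codeweight u1 u2 u3 + q ^ #|B| * (2 * (q ^ #|C| * (q.-1 * q ^ #|A|.-1))))%N.
Proof.
move=> u1B u2n0 u2C; rewrite codeweight_vanishB // -mulnDr leq_mul2l; apply/orP; right.
rewrite -card_bool -card_Delta_neq0 -!sum_nat_const -big_split /=.
apply: leq_sum => e _; set phi := e%:R *: u1 + u3.
apply: (@leq_trans (\sum_(w1 in Delta A :\ (0%R : V))
   (\sum_(w3 in ~: Delta C) (dot u2 w3 + dot phi w1 != 0)%R
    + q ^ #|C| * (dot phi w1 != 0)%R))).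
  apply: leq_sum => w1 _; have := sum_DeltaC_neq u2 (dot phi w1).
  by rewrite sum_Delta_neq_vanish // (negbTE u2n0) => <-; rewrite addnC.
rewrite big_split leq_add2l -big_distrr leq_mul2l /= sum_Delta1_neq.
by case: ifP; rewrite ?leqnn orbT.
Qed.

End Weight.

(** * The lower bound for nonzero codewords *)

Section Bound.
Variables (F : finFieldType) (m : nat) (A B C : {set 'I_m}).
Local Notation V := 'rV[F]_m.
Local Notation Delta := (Delta F).
Local Notation q := #|F|.
Hypotheses (A2 : (2 <= #|A|)%N) (B0 : B != set0) (CT : C != setT).

Definition distance := ((q ^ m - q ^ #|C|) * q ^ (#|A| + #|B| - 1))%N.

Let q1 : (1 < q)%N := card_finNzRing_gt1 F.
Let q0 : (0 < q)%N := ltnW q1.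
Let b0 : (0 < #|B|)%N. Proof. by rewrite card_gt0. Qed.
Let cm : (#|C| < m)%N.
Proof.
by move: CT; rewrite -properT => /proper_card; rewrite cardsT card_ord.
Qed.

Lemma distance_gt0 : (0 < distance)%N.
Proof. by rewrite /distance muln_gt0 subn_gt0 ltn_exp2l // cm expn_gt0 q0. Qed.

(** The right side is the codeweight when u1 vanishes on B, u2 = 0, and e u1 + u3 is nonzero on A
    for exactly one e. *)
Lemma distanceE :
  (q.-1 * distance = q ^ #|B| * ((q ^ m - q ^ #|C|) * (q.-1 * q ^ #|A|.-1)))%N.
Proof.
rewrite /distance (_ : #|A| + #|B| - 1 = #|B| + #|A|.-1)%N; last by lia.
by rewrite expnD; ring.
Qed.

(** The excluded triples form the left kernel of G, so this one bound serves both the distance and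
    the rank. *)
Lemma distance_le_codeweight (u1 u2 u3 : V) :
  ~~ [&& vanish B u1, u2 == 0, vanish A u1 & vanish A u3] ->
  (q.-1 * distance <= codeweight A B C u1 u2 u3)%N.
Proof.
have a0 : (0 < #|A|)%N by lia.
have qA : (q ^ #|A| <= 2 * (q ^ #|A| - 1))%N.
  have : (q ^ 1 <= q ^ #|A|)%N by rewrite leq_exp2l.
  by rewrite expn1; lia.
have eA : (q ^ #|A| = q * q ^ #|A|.-1)%N by rewrite -expnS prednK.
have eB : (q ^ #|B| = q * q ^ #|B|.-1)%N by rewrite -expnS prednK.
have em : (q ^ m = q * q ^ m.-1)%N by rewrite -expnS prednK //; lia.
rewrite distanceE.
have [u1B|u1B _] /= := boolP (vanish B u1); last first.
  rewrite codeweight_B // eB.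
  (* A factor q moves from q^b to q^(a-1), giving q^a, which 2 (q^a - 1) dominates. *)
  rewrite [leqLHS](_ : _ = q ^ #|A| * ((q ^ m - q ^ #|C|) * (q.-1 * q ^ #|B|.-1)))%N;
    last by rewrite eA; ring.
  by rewrite [leqRHS]mulnA leq_mul2r qA orbT.
have [-> /=|u2n0 _] := eqVneq u2 0.
  move=> u13; rewrite codeweight_u2_0 // leq_mul2l; apply/orP; right.
  (* If both choices of e gave zero on A, then e = 0 would make u3 vanish there, and the difference
     would make u1 vanish too. *)
  have [e ue] : exists e : bool, ~~ vanish A (e%:R *: u1 + u3).
    apply/existsP; apply: contraNT u13; rewrite negb_exists => /forallP u13.
    have := u13 true; have := u13 false; rewrite !negbK scale0r scale1r add0r.
    move=> u3A /vanishP u1A; rewrite u3A andbT; apply/vanishP => i iA.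
    by have := u1A i iA; rewrite mxE (vanishP _ _ u3A i iA) addr0.
  by rewrite (bigD1 e) //= (negbTE ue) leq_addr.
have [u2C|u2C] := boolP (vanish C u2); last first.
  have c0 : (0 < #|C|)%N.
    by case/forall_inPn: u2C => i iC _; apply/card_gt0P; exists i.
  have eC : (q ^ #|C| = q * q ^ #|C|.-1)%N by rewrite -expnS prednK.
  rewrite codeweight_u2 // leq_mul2l; apply/orP; right.
  rewrite -!mulnBr [leqRHS]mulnA em eC -mulnBr.
  rewrite [leqLHS](_ : _ = q ^ #|A| * (q.-1 * (q ^ m.-1 - q ^ #|C|.-1)))%N;
    last by rewrite eA; ring.
  by rewrite leq_mul2r qA orbT.
(* The correction term of [codeweight_u2_ge] is added to both sides. *)
rewrite -(leq_add2r (q ^ #|B| * (2 * (q ^ #|C| * (q.-1 * q ^ #|A|.-1))))%N).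
apply: leq_trans (codeweight_u2_ge A u3 u1B u2n0 u2C).
rewrite -mulnDr leq_mul2l; apply/orP; right.
rewrite [leqLHS](_ : _ = q.-1 * ((q ^ m - q ^ #|C| + 2 * q ^ #|C|) * q ^ #|A|.-1))%N;
  last by ring.
rewrite [leqRHS](_ : _ = q.-1 * (2 * (q ^ #|A| - 1) * q ^ m.-1))%N; last by ring.
rewrite leq_mul2l; apply/orP; right.
(* q^C q^(A-1) + 2 q^(m-1) <= q^(m+A-1), since |C| < m and 2 <= min(q, |A|) *)
have eA2 : (q ^ #|A|.-1 = q * q ^ #|A|.-2)%N by rewrite -expnS prednK //; lia.
have hC : (q ^ #|C| <= q ^ m.-1)%N by rewrite leq_exp2l //; lia.
have h2 : (1 <= q ^ #|A|.-2)%N by rewrite expn_gt0 q0.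
rewrite eA em eA2; move: hC h2 q1.
(* Now p = q, z = q^(a-2), y = q^(m-1) and x = q^c, with x <= y, 1 <= z and 1 < p. *)
move: (#|F|) (q ^ #|A|.-2)%N (q ^ m.-1)%N (q ^ #|C|)%N => p z y x xy z1 p1.
have xpy : (x <= p * y)%N by exact: (leq_trans xy (leq_pmull _ (ltnW p1))).
rewrite [(p * y - x + _)%N](_ : _ = p * y + x)%N; last by lia.
have pz : (2 <= p * z)%N by exact: (leq_trans p1 (leq_pmulr _ z1)).
have : (x * (p * z) + 2 * y <= y * (p * (p * z)))%N.
  (* Each term is at most y p z, and 2 <= p absorbs the doubling. *)
  apply: (@leq_trans (y * (p * z) + y * (p * z))%N).
    by apply: leq_add; [rewrite leq_mul2r xy orbT | rewrite mulnC leq_mul2l pz orbT].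
  by rewrite -mulnDr leq_mul2l addnn -mul2n leq_mul2r p1 !orbT.
rewrite mulnBr mulnBl muln1 mulnDl.
rewrite [(p * y * _)%N](_ : _ = y * (p * (p * z)))%N; last by ring.
rewrite [(2 * (p * _) * y)%N](_ : _ = 2 * (y * (p * (p * z))))%N; last by ring.
by move: (y * _)%N (x * _)%N => s t; lia.
Qed.

End Bound.

(** * Entries, weights and columns of the generator matrix *)

Section Code.
Variables (F : finFieldType) (N : nat) (S : {set 'rV[F]_N}).

Lemma mul_genmat u j : (u *m genmat S) 0 j = dot u (enum_val j).
Proof. by rewrite mxE dotE; apply: eq_bigr => i _; rewrite mxE. Qed.

Lemma wt_genmat u : wt (u *m genmat S) = #|[set y in S | dot u y != 0]|.
Proof.
rewrite /wt -(card_imset _ enum_val_inj); apply: eq_card => y.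
rewrite [RHS]inE; apply/imsetP/andP=> [[j]|[yS uy]].
  by rewrite inE mul_genmat => uj ->; rewrite enum_valP.
by exists (enum_rank_in yS y); rewrite ?inE ?mul_genmat enum_rankK_in.
Qed.

Lemma col_genmat j : col j (genmat S) = (enum_val j)^T.
Proof. by apply/colP=> i; rewrite !mxE. Qed.

Lemma sum_col_genmat (T : {set 'I_#|S|}) c j :
  (col j (genmat S) = \sum_(i in T) c i *: col i (genmat S)) <->
  enum_val j = \sum_(i in T) c i *: enum_val i :> 'rV[F]_N.
Proof.
rewrite col_genmat; under eq_bigr do rewrite col_genmat -linearZ.
by rewrite -linear_sum; split=> [/trmx_inj|->].
Qed.

End Code.

(** * Ranks from left kernels, and coordinate selection matrices *)

Lemma mxrank_eq_ker (F : fieldType) n p1 p2 (G : 'M[F]_(n, p1)) (H : 'M[F]_(n, p2)) :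
  (forall u : 'rV[F]_n, (u *m G == 0) = (u *m H == 0)) -> \rank G = \rank H.
Proof.
move=> GH; have eqK : (kermx G :=: kermx H)%MS.
  by apply/eqmxP/andP; split; apply/row_subP=> i; apply/sub_kermxP/eqP;
    [rewrite -GH | rewrite GH]; apply/eqP/sub_kermxP; exact: row_sub.
(* Each rank is the common number of rows minus the dimension of the common kernel. *)
have := mxrank_ker G; rewrite eqK mxrank_ker => E.
by have := rank_leq_row G; have := rank_leq_row H; lia.
Qed.

Section Select.
Variables (F : finFieldType) (m : nat) (P : {set 'I_m}).

(** Right multiplication keeps the coordinates in P, so the left kernel consists of the vectors
    vanishing on P. These matrices are blocks of a model with the same left kernel as G. *)
Definition select_mx : 'M[F]_(m, #|P|) := \matrix_(i, j) (i == enum_val j)%:R.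

Lemma mul_select_mx (u : 'rV[F]_m) j : (u *m select_mx) 0 j = u 0 (enum_val j).
Proof.
rewrite mxE (bigD1 (enum_val j)) //= mxE eqxx mulr1 big1 ?addr0 // => i ij.
by rewrite mxE (negbTE ij) mulr0.
Qed.

Lemma mul_select_mx_eq0 (u : 'rV[F]_m) : (u *m select_mx == 0) = vanish P u.
Proof.
apply/eqP/vanishP => [uP i iP|uP].
  by move/rowP: uP => /(_ (enum_rank_in iP i)); rewrite mul_select_mx enum_rankK_in // mxE.
by apply/rowP=> j; rewrite mul_select_mx mxE uP // enum_valP.
Qed.

Lemma rank_select_mx : \rank select_mx = #|P|.
Proof.
apply/eqP; rewrite eqn_leq rank_leq_col /=.
rewrite -{1}(mxrank1 F #|P|).
suff <- : select_mx^T *m select_mx = 1%:M by rewrite mxrankM_maxr.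
apply/row_matrixP=> i; apply/rowP=> j.
rewrite row_mul mul_select_mx !mxE (inj_eq enum_val_inj).
by rewrite eq_sym.
Qed.

End Select.

(** * Vectors from which columns are split *)

Lemma exists_nonmultiple (F : finFieldType) m (A : {set 'I_m}) (v : 'rV[F]_m) :
  (2 <= #|A|)%N -> exists2 w, w \in Delta F A & forall a, w != a *: v.
Proof.
case/card_gt1P=> i [j [iA jA ij]].
(* Two distinct unit vectors cannot both be multiples of v. *)
pose ei : 'rV[F]_m := delta_mx 0 i; pose ej : 'rV[F]_m := delta_mx 0 j.
case: (pickP (fun a => ei == a *: v)) => [a /eqP eiE|ei_v]; last first.
  by exists ei; rewrite ?Delta_delta // => a; rewrite ei_v.
exists ej; rewrite ?Delta_delta // => b; apply/eqP=> ejE.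
have := congr1 (fun w : 'rV_m => w 0 i) ejE; rewrite !mxE eqxx (negbTE ij) /=.
move/eqP; rewrite eq_sym mulf_eq0 => /orP[/eqP b0|/eqP vi].
  move/rowP: ejE => /(_ j); rewrite b0 scale0r !mxE !eqxx => /eqP.
  by rewrite oner_eq0.
by move/rowP: eiE => /(_ i); rewrite !mxE !eqxx vi mulr0 => /eqP; rewrite oner_eq0.
Qed.

Lemma notin_Delta (F : finFieldType) m (C : {set 'I_m}) (v : 'rV[F]_m) i :
  i \notin C -> v 0 i != 0 -> v \notin Delta F C.
Proof. by move=> iC; apply: contra => /DeltaP ->. Qed.

Lemma notin_DeltaP (F : finFieldType) m (C : {set 'I_m}) (v : 'rV[F]_m) :
  v \notin Delta F C -> exists2 i, i \notin C & v 0 i != 0.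
Proof.
rewrite inE => /subsetPn[i]; rewrite inE => vi iC.
by exists i.
Qed.

(** Let w_i be nonzero with i outside C. If q >= 3, take v = a w with a not 0 or 1. Otherwise use
    another index j outside C: v = e_j if w_j = 0, and v = w_i e_i if not. *)
Lemma split_notin_Delta (F : finFieldType) m (C : {set 'I_m}) (w : 'rV[F]_m) :
  (3 <= #|F|)%N \/ (2 <= #|~: C|)%N -> w \notin Delta F C ->
  exists2 v, v \notin Delta F C & w - v \notin Delta F C.
Proof.
move=> qC wC; case: (notin_DeltaP wC) => i iC wi.
case: qC => [q3|/card_gt1P[j1 [j2 [j1C j2C j12]]]].
  have [a] : exists a : F, (a != 0) && (a != 1).
    apply/existsP; apply: contraTT q3; rewrite negb_exists => /forallP a01.
    rewrite -leqNgt; apply: (@leq_trans #|[set (0 : F); 1]|).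
      by apply/subset_leq_card/subsetP=> a _; have := a01 a; rewrite !inE -negb_or negbK.
    by rewrite cards2; case: (_ != _).
  case/andP=> a0 a1; exists (a *: w); first by rewrite DeltaZE.
  by rewrite -[X in X - _]scale1r -scalerBl DeltaZE // subr_eq0 eq_sym.
have [j jC ij] : exists2 j, j \notin C & j != i.
  rewrite !inE in j1C j2C.
  by have [j1i|] := eqVneq j1 i; [exists j2; rewrite // -j1i eq_sym | exists j1].
have [wj|wj] := eqVneq (w 0 j) 0.
  exists (delta_mx 0 j); apply: (notin_Delta jC); rewrite !mxE ?eqxx ?oner_eq0 //.
  by rewrite wj sub0r oppr_eq0 oner_eq0.
exists (w 0 i *: delta_mx 0 i).
  by apply: (notin_Delta iC); rewrite !mxE !eqxx mulr1.
by apply: (notin_Delta jC); rewrite !mxE (negbTE ij) andbF mulr0 subr0.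
Qed.

Lemma card2_eq1 (F : finFieldType) (a : F) : #|F| = 2%N -> a != 0 -> a = 1.
Proof.
move=> q2; have /cards1P[b bE] : #|[set~ (0 : F)]| == 1%N by rewrite cardsC1 q2.
have bP x : (x != 0) = (x == b) by move/setP: bE => /(_ x); rewrite !inE.
by rewrite bP => /eqP ->; apply/esym/eqP; rewrite -bP oner_eq0.
Qed.

Lemma card2_add11 (F : finFieldType) : #|F| = 2%N -> 1 + 1 = 0 :> F.
Proof.
move=> q2; apply/eqP/negPn/negP=> /(card2_eq1 q2)/eqP.
by rewrite -subr_eq0 addrK oner_eq0.
Qed.

(** * Repair by sums in N_4, and lower bounds for the locality *)

Section Locality.
Variables (F : finFieldType) (m : nat) (A B C : {set 'I_m}).
Variable S : {set 'rV[F]_(m + (m + m))}.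
Hypothesis SP : projRepr A B C S.
Local Notation N4 := (N4set F A B C).

(** Summands may be taken in N_4, since each is a multiple of a column. Not being proportional to x
    keeps the column of x out of the repair set. *)
Lemma repair_of_sum r :
  (forall x, x \in S -> exists s : seq 'rV[F]_(m + (m + m)),
     [/\ (size s <= r)%N, {subset s <= N4},
         forall y a, y \in s -> y != a *: x & x = \sum_(y <- s) y]) ->
  repair_r (genmat S) r.
Proof.
move=> decomp j; have [s [s_r sN s_x xE]] := decomp _ (enum_valP j).
have /fin_all_exists[p pP] : forall k : 'I_(size s), exists p : F * 'I_#|S|,
    p.1 != 0 /\ p.1 *: tnth (in_tuple s) k = enum_val p.2.
  move=> k; have yN : tnth (in_tuple s) k \in N4 by rewrite sN ?mem_tnth.
  have [a a0 ayS] := projRepr_ex SP yN.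
  by exists (a, enum_rank_in ayS (a *: tnth (in_tuple s) k)); rewrite enum_rankK_in.
(* Summands of one class share a column, so their coefficients are added. *)
exists [set (p k).2 | k in setT], (fun i => \sum_(k | (p k).2 == i) (p k).1^-1).
split.
- apply/imsetP=> -[k _ jE]; have [p0 pk] := pP k.
  have := s_x (tnth (in_tuple s) k) (p k).1^-1 (mem_tnth _ _).
  by rewrite jE -pk scalerA mulVf // scale1r eqxx.
- by rewrite (leq_trans (leq_imset_card _ _)) // cardsT card_ord.
apply/sum_col_genmat; rewrite xE big_tnth.
rewrite (partition_big (fun k => (p k).2) (mem [set (p k).2 | k in setT])) /=; last first.
  by move=> k _; apply: imset_f; rewrite inE.
apply: eq_bigr => i _; rewrite scaler_suml; apply: eq_bigr => k /eqP <-.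
by have [p0 <-] := pP k; rewrite scalerA mulVf // scale1r.
Qed.

(* A single nonzero coefficient would make two distinct elements of S proportional. *)
Lemma repair_coef_gt1 j (T : {set 'I_#|S|}) c :
  j \notin T -> enum_val j = \sum_(i in T) c i *: enum_val i :> 'rV[F]_(m + (m + m)) ->
  (1 < #|[set i in T | c i != 0%R]|)%N.
Proof.
move=> jT; set T' := [set i in T | c i != 0].
have -> : \sum_(i in T) c i *: enum_val i = \sum_(i in T') c i *: enum_val i.
  rewrite [LHS](bigID (fun i => c i != 0)) /= [X in _ + X]big1 ?addr0 => [|i].
    by apply: eq_bigl => i; rewrite inE.
  by case/andP=> _ /negPn/eqP ->; rewrite scale0r.
move=> jE; rewrite ltnNge; apply/negP; rewrite leq_eqVlt ltnS leqn0 cards_eq0.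
case/orP=> [/cards1P[i T'E]|/eqP T'0].
  move: jE; rewrite T'E big_set1 => jE.
  have iT : i \in T' by rewrite T'E set11.
  have /enum_val_inj ij := projRepr_eq SP (enum_valP i) (enum_valP j) jE.
  by move: iT jT; rewrite inE ij => /andP[->].
have := N4set_neq0 (projRepr_sub SP (enum_valP j)).
by rewrite jE T'0 big_set0 eqxx.
Qed.

Lemma repair_ge2 r : (0 < #|S|)%N -> repair_r (genmat S) r -> (2 <= r)%N.
Proof.
move=> S0 /(_ (Ordinal S0))[T [c [jT Tr /sum_col_genmat jE]]].
apply: leq_trans (repair_coef_gt1 jT jE) (leq_trans _ Tr).
by rewrite subset_leq_card //; apply/subsetP=> i; rewrite inE => /andP[].
Qed.

(** The functional [f] reads the w3-coordinate outside C and is 1 on every column, so the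
    coefficients sum to 1. Over F_2 the number of nonzero ones is therefore odd; being greater than
    1, it is at least 3. *)
Lemma repair_ge3 r : #|F| = 2%N -> #|~: C| = 1%N ->
  (0 < #|S|)%N -> repair_r (genmat S) r -> (3 <= r)%N.
Proof.
move=> q2 C1 S0 /(_ (Ordinal S0))[T [c [jT Tr /sum_col_genmat jE]]].
have F2 a := @card2_eq1 F a q2; have two0 := card2_add11 q2.
have /cards1P[k Ck] : #|~: C| == 1%N by rewrite C1.
pose f : 'rV[F]_(m + (m + m)) := row_mx 0 (row_mx (delta_mx 0 k) 0).
(* Every w3 outside Delta_C has coordinate 1 at the only index not in C. *)
have fN y : y \in N4 -> dot f y = 1.
  case/imsetP=> -[[[e w1] w2] w3]; rewrite inE /= => /and3P[_ _].
  rewrite in_setC => /notin_DeltaP[i iC w3i] ->.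
  rewrite !dot_row_mx !dot0l add0r addr0 delta_dot; apply: F2.
  suff -> : k = i by [].
  by apply/esym/eqP; rewrite -in_set1 -Ck inE.
have fS (i : 'I_#|S|) : dot f (enum_val i) = 1
  by exact: (fN _ (projRepr_sub SP (enum_valP i))).
have sumc : \sum_(i in T) c i = 1.
  rewrite -(fS (Ordinal S0)) jE /dot linear_sum /= mulmx_sumr summxE.
  apply: eq_bigr => i _; rewrite -[X in X = _]mulr1 -(fS i).
  by rewrite -dotZr.
have cardT' : #|[set i in T | c i != 0%R]|%:R = 1 :> F.
  rewrite -[RHS]sumc -[#|[set _ in T | _]|]sum1_card natr_sum big_mkcond [RHS]big_mkcond /=.
  apply: eq_bigr => i _; rewrite inE; case: (i \in T) => //=.
  by have [->|/F2] := eqVneq (c i) 0.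
have T'gt1 := repair_coef_gt1 jT jE.
have T'T : (#|[set i in T | c i != 0%R]| <= #|T|)%N.
  by rewrite subset_leq_card //; apply/subsetP=> i; rewrite inE => /andP[].
rewrite (leq_trans _ Tr) // (leq_trans _ T'T) // ltn_neqAle T'gt1 andbT.
apply/eqP=> T'2; move/eqP: cardT'; rewrite -T'2 mulr2n two0 eq_sym.
by rewrite oner_eq0.
Qed.

End Locality.

(** * Length, dimension, distance and locality of the code *)

Section CodeParams.
Variables (F : finFieldType) (m : nat) (A B C : {set 'I_m}).
Variable S : {set 'rV[F]_(m + (m + m))}.
Hypotheses (SP : projRepr A B C S) (AB : A :&: B = set0).
Hypotheses (A2 : (2 <= #|A|)%N) (B0 : B != set0) (CT : C != setT).
Local Notation N4 := (N4set F A B C).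
Local Notation q := #|F|.
Local Notation V := 'rV[F]_m.
Local Notation G := (genmat S).

Let q1 : (0 < q.-1)%N. Proof. by rewrite -subn1 subn_gt0 card_finNzRing_gt1. Qed.

Lemma card_S : (#|S| * q.-1 = 2 * (q ^ m - q ^ #|C|) * (q ^ #|A| - 1) * q ^ #|B|)%N.
Proof.
have -> : S = [set y in S | predT y] by apply/setP=> y; rewrite !inE andbT.
rewrite (card_projRepr SP) // card_N4set_sum //.
under eq_bigr do under eq_bigr do under eq_bigr do rewrite sum1_card card_DeltaC.
rewrite !sum_nat_const card_bool card_Delta_neq0 card_Delta; ring.
Qed.

(** Being nonzero is invariant under scaling, so the count over S lifts to N_4 with factor q - 1. *)
Lemma wt_codeweight (u1 u2 u3 : V) :
  (wt (row_mx u1 (row_mx u2 u3) *m G) * q.-1 = codeweight A B C u1 u2 u3)%N.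
Proof.
rewrite wt_genmat (card_projRepr SP) => [|a x a0]; last first.
  by rewrite dotZr mulf_eq0 (negbTE a0).
rewrite card_N4set_sum //; do 4![apply: eq_bigr => ? _].
rewrite /= !dot_row_mx dotDr dotDl dotZr dotZl; congr (nat_of_bool (_ != _)); ring.
Qed.

Lemma genmat_eq0 (u1 u2 u3 : V) :
  (row_mx u1 (row_mx u2 u3) *m G == 0) =
  [&& vanish B u1, u2 == 0, vanish A u1 & vanish A u3].
Proof.
apply/idP/idP.
  move=> /eqP uG0; apply: contraT => /(distance_le_codeweight A2 B0 CT).
  rewrite -wt_codeweight uG0 leqNgt (_ : wt 0 = 0)%N; last first.
    by apply: eq_card0 => j; rewrite !inE mxE eqxx.
  by rewrite muln_gt0 q1 distance_gt0.
case/and4P=> u1B /eqP -> u1A u3A; apply/eqP/rowP=> j; rewrite mul_genmat mxE.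
have /imsetP[[[[e w1] w2] w3]] := projRepr_sub SP (enum_valP j).
rewrite mem_N4dom => /and4P[_ w1A w2B _] ->.
rewrite !dot_row_mx dotDr dotZr dot0l (dot_vanish u1B w2B).
by rewrite (dot_vanish u1A w1A) (dot_vanish u3A w1A) mulr0 !addr0.
Qed.

Lemma rank_genmat : \rank G = (m + 2 * #|A| + #|B|)%N.
Proof.
(* The left kernel of G asks u1 to vanish on the union of A and B, u2 to be zero and u3 to vanish on
   A; [H] imposes just this, block by block. *)
pose H := block_mx (select_mx F (A :|: B)) 0 0
                   (block_mx (1%:M : 'M_m) 0 0 (select_mx F A)).
rewrite (@mxrank_eq_ker _ _ _ _ G H) => [|u]; last first.
  rewrite -[u]hsubmxK -[rsubmx u]hsubmxK genmat_eq0.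
  rewrite !mul_row_block !mulmx0 !addr0 !add0r !row_mx_eq0 mulmx1.
  rewrite !mul_select_mx_eq0; set u1 := lsubmx u.
  have -> : vanish (A :|: B) u1 = vanish B u1 && vanish A u1.
    apply/vanishP/andP=> [h|[/vanishP hB /vanishP hA] i].
      by split; apply/vanishP=> i iP; apply: h; rewrite inE iP ?orbT.
    by rewrite inE => /orP[/hA|/hB].
  by rewrite -!andbA; congr andb; rewrite andbCA.
rewrite !rank_diag_block_mx mxrank1 !rank_select_mx cardsU AB cards0 subn0; lia.
Qed.

Lemma min_dist_genmat : min_dist G (distance F A B C).
Proof.
split; last first.
  move=> u; rewrite -[u]hsubmxK -[rsubmx u]hsubmxK genmat_eq0.
  move=> /(distance_le_codeweight A2 B0 CT).
  by rewrite -wt_codeweight mulnC leq_pmul2r.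
have [i iA] : exists i, i \in A by apply/card_gt0P; lia.
have iB : i \notin B by have := in_set0 i; rewrite -AB inE iA /= => ->.
(* With u2 = u3 = 0 and u1 = e_i, i in A but not in B, only e = 1 contributes, so the bound is
   attained. *)
pose u1 : V := delta_mx 0 i.
have u1A : vanish A u1 = false.
  by apply/vanishP=> /(_ i iA)/eqP; rewrite mxE !eqxx oner_eq0.
exists (row_mx u1 (row_mx 0 0)); split; first by rewrite genmat_eq0 u1A !andbF.
apply/eqP; rewrite -(eqn_pmul2r q1) wt_codeweight codeweight_u2_0; last first.
  apply/vanishP=> j jB; rewrite mxE eqxx; case: (j =P i) jB => [->|//].
  by rewrite (negbTE iB).
rewrite big_bool scale1r scale0r !addr0 u1A.
rewrite [vanish A 0](introT (vanishP _ _)) => [|j _]; last by rewrite mxE.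
by rewrite /= muln0 addn0 [X in _ == X]mulnC distanceE.
Qed.

(** A codeword of positive weight requires a column. *)
Lemma card_S_gt0 : (0 < #|S|)%N.
Proof.
have [[u [_ uwt]] _] := min_dist_genmat.
have := distance_gt0 F A B CT; rewrite -uwt => h.
by rewrite (leq_trans h) // -[leqRHS]card_ord max_card.
Qed.

Lemma locality2 : ((3 <= q)%N \/ (2 <= #|~: C|)%N) -> locality G 2.
Proof.
move=> qC; split=> // [|r _]; last exact: (repair_ge2 SP card_S_gt0).
apply: (repair_of_sum SP) => x /(projRepr_sub SP)/imsetP[[[[e w1] w2] w3]].
rewrite mem_N4dom => /and4P[w10 w1A w2B w3C] ->.
have [w wA ww1] := exists_nonmultiple w1 A2.
have [v vC vwC] := split_notin_Delta qC w3C.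
(* Keeping the same e in both terms makes omega split along with w1. Neither w nor w1 - w is a
   multiple of w1, so neither term is proportional to the column. *)
exists [:: N4vec (e, w, w2, v); N4vec (e, w1 - w, 0, w3 - v)]; split=> //.
- move=> y; rewrite !inE => /orP[] /eqP ->; apply: imset_f; rewrite mem_N4dom.
    rewrite wA w2B vC !andbT.
    by have := ww1 0; rewrite scale0r.
  rewrite DeltaB // Delta0 vwC !andbT subr_eq0 eq_sym.
  by have := ww1 1; rewrite scale1r.
- move=> y a; rewrite !inE => /orP[] /eqP ->; apply/eqP;
    rewrite /= !scale_row_mx => /eq_row_mx[_ /eq_row_mx[_ wE]].
    by have := ww1 a; rewrite wE eqxx.
  have := ww1 (1 - a); rewrite scalerBl scale1r -wE opprB addrC subrK eqxx //.
rewrite big_cons big_seq1 /= !add_row_mx add0r.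
by rewrite -addrA -scalerDr ![_ + (_ - _)]addrC !subrK.
Qed.

Lemma locality3 : q = 2%N -> #|~: C| = 1%N -> locality G 3.
Proof.
move=> q2 C1; split=> // [|r _]; last exact: (repair_ge3 SP q2 C1 card_S_gt0).
have two0 : 2%:R = 0 :> F.
  exact: card2_add11.
apply: (repair_of_sum SP) => x /(projRepr_sub SP)/imsetP[[[[e w1] w2] w3]].
rewrite mem_N4dom => /and4P[w10 w1A w2B w3C] ->.
have [w wA ww1] := exists_nonmultiple w1 A2.
have w0 : w != 0 by have := ww1 0; rewrite scale0r.
have [i iB] : exists i, i \in B by apply/set0Pn.
pose b : V := delta_mx 0 i.
have bB : b \in Delta F B by rewrite Delta_delta.
have b0 : b != 0.
  by apply/eqP=> /rowP/(_ i)/eqP; rewrite !mxE !eqxx oner_eq0.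
(* In characteristic 2 the two copies of b, of w and the extra two of w3 cancel. *)
exists [:: N4vec (e, w1, w2 + b, w3); N4vec (false, w, b, w3); N4vec (false, w, 0, w3)].
split=> //.
- by move=> y; rewrite !inE => /or3P[] /eqP ->; apply: imset_f; rewrite mem_N4dom;
    rewrite ?DeltaD ?Delta0 ?w0 ?w10 ?wA ?w1A ?w3C ?bB.
- move=> y a; rewrite !inE => /or3P[] /eqP ->; apply/eqP;
    rewrite /= !scale_row_mx => /eq_row_mx[+ /eq_row_mx[_ wE]]; last 2 first.
  + by have := ww1 a; rewrite wE eqxx.
  + by have := ww1 a; rewrite wE eqxx.
  (* The first term shares the block w1 with the column, which forces the scalar 1; then the first
     blocks still differ by b. *)
  have a1 : a = 1.
    apply/eqP; rewrite -subr_eq0; have /eqP : (a - 1) *: w1 = 0.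
      by rewrite scalerBl scale1r -wE subrr.
    by rewrite scaler_eq0 (negbTE w10) orbF.
  rewrite a1 scale1r addrAC -[RHS]addr0 => /addrI/eqP.
  by rewrite (negbTE b0).
have vv (v : V) : v + v = 0 by rewrite -mulr2n -scaler_nat two0 scale0r.
rewrite !big_cons big_nil /= addr0 !add_row_mx scale0r !addr0 !vv addr0.
by rewrite [w2 + b + _ + b]addrAC -[w2 + b + b]addrA vv !addr0.
Qed.

End CodeParams.

(** * Assembly of the parameters in the two cases *)

Theorem mainTheorem19 (F : finFieldType) (q m : nat) (A B C : {set 'I_m})
  (S : {set 'rV[F]_(m + (m + m))}) :
  #|F| = q -> (2 <= m)%N ->
  A != set0 -> B != set0 -> C != set0 ->
  A :&: B = set0 -> C != setT -> (2 <= #|A|)%N ->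
  projRepr A B C S ->
  ( ((3 <= q)%N \/ (q = 2%N /\ (2 <= #|~: C|)%N)) ->
      is_LRC (genmat S)
        ((2 * (q ^ m - q ^ #|C|) * (q ^ #|A| - 1) * q ^ #|B|) %/ (q - 1))%N
        (m + 2 * #|A| + #|B|)%N
        ((q ^ m - q ^ #|C|) * q ^ (#|A| + #|B| - 1))%N
        2 ) /\
  ( (q = 2%N /\ #|~: C| = 1%N) ->
      is_LRC (genmat S)
        ((2 ^ #|A| - 1) * 2 ^ (m + #|B|))%N
        (m + 2 * #|A| + #|B|)%N
        (2 ^ (m + #|A| + #|B| - 2))%N
        3 ).
Proof.
move=> <- _ _ B0 _ AB CT A2 SP.
have rk := rank_genmat SP AB A2 B0 CT.
have md := min_dist_genmat SP AB A2 B0 CT.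
have cS := card_S SP AB.
split=> [qC|[q2 C1]].
  split=> //.
    (* The division is exact, the dividend being |S| (q - 1). *)
    by rewrite -cS subn1 mulnK // -subn1 subn_gt0 card_finNzRing_gt1.
  by apply: (locality2 SP) => //; case: qC => [|[_]]; [left|right].
(* Here |C| = m - 1, so 2^m - 2^c = 2^c, which brings length and distance to the form of case
   (b). *)
have cC : (#|C| + 1 = m)%N by have := cardsC C; rewrite C1 card_ord.
have em : (2 ^ m = 2 ^ #|C| * 2)%N by rewrite -(expnD 2 _ 1) cC.
have two_m : (2 ^ m - 2 ^ #|C| = 2 ^ #|C|)%N by lia.
split=> //; last exact: (locality3 SP).
  by move: cS; rewrite q2 two_m muln1 expnD em => ->; ring.
move: md; rewrite /distance q2 two_m -expnD.
by congr (min_dist _ (2 ^ _)); lia.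
Qed.
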